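(* $$\sup \omega(2,4) = 4 + 2\sqrt{2-\sqrt{3}},$$ that is, $$\max\left\{ \frac{\sigma(S)}{D(S)} \;\middle|\; S \subset E^2,\ |S| = 4 \right\} = 4 + 2\sqrt{2-\sqrt{3}}.$$
   Context: $E^m$ denotes $m$-dimensional Euclidean space and $\|AB\|$ denotes the Euclidean distance between points $A$ and $B$. For a finite point set $S=\{A_1,A_2,\dots,A_n\}\subset E^m$ with $|S|=n$ ($n\ge 2$ distinct points), define $\sigma(S)=\sum_{1\le i<j\le n}\|A_iA_j\|$ (the sum of all pairwise distances) and $D(S)=\max_{1\le i<j\le n}\|A_iA_j\|$ (the diameter). Write $\omega(m,n)=\sigma(S)/D(S)$ for such a set $S$, and define $\sup\omega(m,n)=\max\{\sigma(S)/D(S) \mid S\subset E^m,\ |S|=n\}$. *)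

(* Defs.v *)
From mathcomp Require Import all_boot all_order all_algebra.
From mathcomp Require Import classical_sets reals.

Set Implicit Arguments.
Unset Strict Implicit.
Unset Printing Implicit Defensive.

Import Order.TTheory GRing.Theory Num.Theory.

Local Open Scope ring_scope.
Local Open Scope classical_set_scope.

(* The library norm on 'rV[R]_m is the sup norm, so the Euclidean distance is
   written out. *)
Definition edist (R : realType) (m : nat) (x y : 'rV[R]_m) : R :=
  Num.sqrt (\sum_(k < m) (x 0 k - y 0 k) ^+ 2).

(* An n-point set {A_1, ..., A_n} of E^m is given by an injective family
   A : 'I_n -> 'rV[R]_m; sigma and diam do not depend on the enumeration. *)
Definition sigma (R : realType) (m n : nat) (A : 'I_n -> 'rV[R]_m) : R :=
  \sum_(i < n) \sum_(j < n | (i < j)%N) edist (A i) (A j).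

(* The default value 0 is harmless, since all distances are nonnegative. *)
Definition diam (R : realType) (m n : nat) (A : 'I_n -> 'rV[R]_m) : R :=
  \big[Num.max/0]_(i < n) \big[Num.max/0]_(j < n | (i < j)%N)
    edist (A i) (A j).

Definition omega_values (R : realType) (m n : nat) : set R :=
  [set sigma A / diam A | A in [set A : 'I_n -> 'rV[R]_m | injective A]].

(* w is the maximum (attained, not merely the supremum) of the ratios. *)
Definition is_sup_omega (R : realType) (m n : nat) (w : R) : Prop :=
  @omega_values R m n w /\ ubound (@omega_values R m n) w.

(* Main.v *)
Require Import Defs.
From mathcomp Require Import all_boot all_order all_algebra.
From mathcomp Require Import classical_sets reals.
From mathcomp Require Import ring lra.

(** Scale so that all six distances are at most 1, and let
    [kappa = 2 sqrt (2 - sqrt 3)]. The bound [4 + kappa] is reached by an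
    equilateral triangle of side 1 together with the middle of an arc of radius
    1 centered at one vertex and joining the other two.

    By Radon's theorem ([exists_affine_dep], [bounded_of_dep]) either one point
    lies in the triangle of the three others, or two segments [AC] and [BD]
    between the points cross. In the first case convexity of the distance bounds
    the sum by 5 ([sum_dist_inside]). In the second case the diagonals add up to
    at most 2, and it remains to bound the perimeter of [ABCD] by [2 + kappa]
    ([perim_le_kappa]).

    The perimeter grows when the ends of a diagonal slide outwards along its
    line. Each diagonal is therefore stretched until it has length 1
    ([perim_stretch]), unless two sides with a common end reach length 1 first,
    a case settled by an inscribed angle estimate ([isosceles]). Once both
    diagonals have length 1, translating one of them turns the four sides into
    the distances from a point to the vertices of a rhombus of side 1
    ([perim_unit]). The sum of these distances is convex in the point, and the
    point is confined to the unit discs about the vertices. By symmetry a quarter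
    of this region suffices; it is bounded by the axes and two circular arcs,
    and replacing each arc by its tangent at their common corner gives a
    quadrilateral, at whose vertices the sum is at most [2 + kappa]
    ([rhombus_sum_le]; a single tangent suffices when the rhombus is flat,
    [rhombus_sum_flat]). At the corner the sum is
    [2 + (sqrt 3 - 1) (a + b)], where [a] and [b] are the half diagonals of the
    rhombus, and [a + b <= sqrt 2] ([rhombus_sum_corner]); equality means that
    the diagonals of [ABCD] are perpendicular, as in the extremal
    configuration. *)

Set Implicit Arguments.
Unset Strict Implicit.
Unset Printing Implicit Defensive.

Import Order.TTheory GRing.Theory Num.Theory.

Local Open Scope ring_scope.

(** * Euclidean norm of the plane and constants *)

Section Norm.
Variable R : rcfType.
Implicit Types (x y k : R).

Lemma sqrt_le_of_sqr x y : 0 <= y -> x <= y ^+ 2 -> Num.sqrt x <= y.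
Proof.
by move=> y0 xy; rewrite -(ger0_norm y0) -sqrtr_sqr; exact: ler_wsqrtr.
Qed.

Definition hyp x y : R := Num.sqrt (x ^+ 2 + y ^+ 2).

Lemma hyp_ge0 x y : 0 <= hyp x y.
Proof. exact: sqrtr_ge0. Qed.

Lemma sqr_hyp x y : hyp x y ^+ 2 = x ^+ 2 + y ^+ 2.
Proof. by rewrite sqr_sqrtr // addr_ge0 ?sqr_ge0. Qed.

Lemma hypNN x y : hyp (- x) (- y) = hyp x y.
Proof. by rewrite /hyp !sqrrN. Qed.

Lemma hyp_swap x y : hyp x y = hyp y x.
Proof. by rewrite /hyp addrC. Qed.

Lemma hyp_x0 x : hyp x 0 = `|x|.
Proof. by rewrite /hyp expr0n addr0 sqrtr_sqr. Qed.

Lemma hyp_scale k x y : 0 <= k -> hyp (k * x) (k * y) = k * hyp x y.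
Proof.
move=> k0; rewrite /hyp !exprMn -mulrDr sqrtrM ?sqr_ge0 //.
by rewrite sqrtr_sqr ger0_norm.
Qed.

Lemma dot_le_hyp x y x' y' : x * x' + y * y' <= hyp x y * hyp x' y'.
Proof.
apply: le_trans (ler_norm _) _; rewrite -sqrtr_sqr.
apply: sqrt_le_of_sqr; first by rewrite mulr_ge0 ?hyp_ge0.
rewrite exprMn !sqr_hyp; have := sqr_ge0 (x * y' - y * x'); nra.
Qed.

Lemma hyp_triangle x y x' y' : hyp (x + x') (y + y') <= hyp x y + hyp x' y'.
Proof.
apply: sqrt_le_of_sqr; first by rewrite addr_ge0 ?hyp_ge0.
rewrite [leRHS]sqrrD !sqr_hyp; have := dot_le_hyp x y x' y'; lra.
Qed.

Lemma hyp_comb2 k1 k2 x1 y1 x2 y2 : 0 <= k1 -> 0 <= k2 ->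
  hyp (k1 * x1 + k2 * x2) (k1 * y1 + k2 * y2)
    <= k1 * hyp x1 y1 + k2 * hyp x2 y2.
Proof.
by move=> k10 k20; rewrite -!hyp_scale //; exact: hyp_triangle.
Qed.

Lemma hyp_comb3 k1 k2 k3 x1 y1 x2 y2 x3 y3 :
  0 <= k1 -> 0 <= k2 -> 0 <= k3 ->
  hyp (k1 * x1 + k2 * x2 + k3 * x3) (k1 * y1 + k2 * y2 + k3 * y3)
    <= k1 * hyp x1 y1 + k2 * hyp x2 y2 + k3 * hyp x3 y3.
Proof.
move=> k10 k20 k30; apply: le_trans (hyp_triangle _ _ _ _) _.
by rewrite hyp_scale // lerD2r; exact: hyp_comb2.
Qed.

(** The sum of the two short sides of the extremal kite; its value 4 sin (pi / 12)
is also [(sqrt 3 - 1) * sqrt 2]. *)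
Definition kappa : R := 2 * Num.sqrt (2 - Num.sqrt 3).

Lemma sqrt3_sqr : Num.sqrt 3 ^+ 2 = 3 :> R.
Proof. by rewrite sqr_sqrtr. Qed.

Lemma sqrt3_bounds : 45 / 26 <= Num.sqrt (3 : R) <= 26 / 15.
Proof.
have s2 := sqrt3_sqr; have s0 := sqrtr_ge0 (3 : R).
by apply/andP; split; nra.
Qed.

Lemma kappa_ge0 : 0 <= kappa.
Proof. by rewrite mulr_ge0 // sqrtr_ge0. Qed.

Lemma sqr_kappa : kappa ^+ 2 = 8 - 4 * Num.sqrt 3.
Proof.
have /andP[_ s] := sqrt3_bounds.
by rewrite exprMn sqr_sqrtr; [ring | lra].
Qed.

Lemma kappa_ge : 103 / 100 <= kappa.
Proof.
have k2 := sqr_kappa; have k0 := kappa_ge0; have /andP[_ s] := sqrt3_bounds.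
nra.
Qed.

End Norm.

(** * A point and the vertices of a unit rhombus *)

Section Rhombus.
Variable R : rcfType.
Implicit Types (a b x y : R).

(** With [a ^+ 2 + b ^+ 2 = 1], the points [(-a, 0)], [(0, b)], [(a, 0)],
[(0, -b)] are the vertices [W], [X], [Y], [Z] of a rhombus of side 1; the
sum of the distances from [(x, y)] to them. *)
Definition rhombus_sum a b x y : R :=
  hyp (x + a) y + hyp (x - a) y + hyp x (y + b) + hyp x (y - b).

Lemma rhombus_sum_swap a b x y : rhombus_sum a b x y = rhombus_sum b a y x.
Proof.
rewrite /rhombus_sum (hyp_swap (x + a)) (hyp_swap (x - a)).
by rewrite (hyp_swap x (y + b)) (hyp_swap x (y - b)); ring.
Qed.

Lemma rhombus_sum_normx a b x y : rhombus_sum a b `|x| y = rhombus_sum a b x y.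
Proof.
case: (ger0P x) => // x0; rewrite /rhombus_sum /hyp sqrrN.
have -> : (- x + a) ^+ 2 = (x - a) ^+ 2 by ring.
have -> : (- x - a) ^+ 2 = (x + a) ^+ 2 by ring.
by ring.
Qed.

Lemma rhombus_sum_norm a b x y : rhombus_sum a b `|x| `|y| = rhombus_sum a b x y.
Proof. by rewrite rhombus_sum_normx rhombus_sum_swap rhombus_sum_normx rhombus_sum_swap. Qed.

(** Convexity on the triangle with vertices the center, [(x1, y1)] and
[(x2, y2)]: a bound need only be checked at these three points. *)
Lemma rhombus_sum_comb a b k1 k2 x1 y1 x2 y2 B :
  0 <= k1 -> 0 <= k2 -> k1 + k2 <= 1 ->
  rhombus_sum a b x1 y1 <= B -> rhombus_sum a b x2 y2 <= B -> rhombus_sum a b 0 0 <= B ->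
  rhombus_sum a b (k1 * x1 + k2 * x2) (k1 * y1 + k2 * y2) <= B.
Proof.
move=> k10 k20 k12 h1 h2 h3; have k30 : 0 <= 1 - k1 - k2 by lra.
have H u v : hyp (k1 * x1 + k2 * x2 + u) (k1 * y1 + k2 * y2 + v) <=
   k1 * hyp (x1 + u) (y1 + v) + k2 * hyp (x2 + u) (y2 + v) +
   (1 - k1 - k2) * hyp (0 + u) (0 + v).
  have := hyp_comb3 (x1 + u) (y1 + v) (x2 + u) (y2 + v) (0 + u) (0 + v)
     k10 k20 k30.
  by congr (hyp _ _ <= _); ring.
have := H a 0; have := H (- a) 0; have := H 0 b; have := H 0 (- b).
rewrite !addr0; move: h1 h2 h3; rewrite /rhombus_sum; nra.
Qed.

Lemma rhombus_sum_center a b B : a ^+ 2 + b ^+ 2 = 1 -> 0 <= a -> 0 <= b ->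
  3 <= B -> rhombus_sum a b 0 0 <= B.
Proof.
move=> ab a0 b0 B3; rewrite /rhombus_sum !add0r.
rewrite ![hyp 0 _]hyp_swap !hyp_x0 !normrN !ger0_norm //.
by have := sqr_ge0 (a - 2 / 3); have := sqr_ge0 (b - 2 / 3); nra.
Qed.

(** A disc lies on one side of each of its tangents; this replaces a circular
constraint by a linear one. *)
Lemma dot_le1 x1 y1 x y : hyp x1 y1 <= 1 -> hyp x y <= 1 ->
  x1 * x + y1 * y <= 1.
Proof.
move=> h1 h2; apply: le_trans (dot_le_hyp _ _ _ _) _.
by rewrite mulr_ile1 ?hyp_ge0.
Qed.

(** The sector of the constraint triangle between the first axis and the ray
through [(u, v)], cut by the line [n1 * x + n2 * y = m]. The line meets the
axis at [(g, 0)] and passes through [(u, v)], so the region is the triangle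
with these two vertices and the center. *)
Lemma rhombus_sum_triangle a b B n1 n2 m g u v x y :
  0 < g -> 0 < v -> 0 < n1 -> n1 * g = m -> n1 * u + n2 * v = m ->
  0 <= y -> y * u <= x * v -> n1 * x + n2 * y <= m ->
  rhombus_sum a b g 0 <= B -> rhombus_sum a b u v <= B -> rhombus_sum a b 0 0 <= B ->
  rhombus_sum a b x y <= B.
Proof.
move=> g0 v0 n0 gm uvm y0 sec xym hG hQ hK.
have gn : g != 0 by rewrite gt_eqF.
have vn : v != 0 by rewrite gt_eqF.
have k20 : 0 <= y / v by rewrite divr_ge0 // ltW.
have k10 : 0 <= (x * v - y * u) / (v * g).
  by rewrite divr_ge0 ?subr_ge0 // mulr_ge0 // ltW.
have k12 : (x * v - y * u) / (v * g) + y / v <= 1.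
  have -> : (x * v - y * u) / (v * g) + y / v = (x * v - y * u + y * g) / (v * g).
    by field; rewrite gn vn.
  rewrite ler_pdivrMr ?mul1r; last exact: mulr_gt0.
  rewrite -(ler_pM2l n0); nra.
have := rhombus_sum_comb k10 k20 k12 hG hQ hK.
by congr (rhombus_sum _ _ _ _ <= _); field; rewrite ?gn ?vn.
Qed.

(** In a flat rhombus the tangent at [X] to the unit circle about [W] already
confines the point to the triangle with vertices the center, [X] and
[(b ^+ 2 / a, 0)], and the sum is at most 3 at each of them. *)
Lemma rhombus_sum_flat a b x y : 0 <= a -> 0 <= b -> b <= 1 / 2 ->
  a ^+ 2 + b ^+ 2 = 1 -> 0 <= x -> 0 <= y -> hyp (x + a) y <= 1 ->
  rhombus_sum a b x y <= 3.
Proof.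
move=> a0 b0 b12 ab x0 y0 hW.
have K3 := rhombus_sum_center ab a0 b0 (lexx 3).
have hX : hyp a b = 1 by rewrite /hyp ab sqrtr1.
have T : a * x + b * y <= b ^+ 2.
  have hX' : hyp a b <= 1 by rewrite hX.
  have := dot_le1 hX' hW; nra.
have a1 : 6 / 7 <= a by nra.
have [b_eq0|bn0] := eqVneq b 0.
  have -> : x = 0 by nra.
  have -> : y = 0.
    have : hyp (x + a) y ^+ 2 <= 1 by rewrite expr_le1 ?hyp_ge0.
    rewrite sqr_hyp; nra.
  exact: K3.
have bp : 0 < b by rewrite lt_def bn0.
have an0 : a != 0 by apply/eqP; lra.
apply: (@rhombus_sum_triangle a b 3 a b (b ^+ 2) (b ^+ 2 / a) 0 b) => //.
- by rewrite divr_gt0 ?exprn_gt0 //; lra.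
- by lra.
- by field.
- by ring.
- by rewrite mulr0 mulr_ge0.
- have e : b ^+ 2 / a + a = 1 / a by rewrite -[1]ab; field.
  rewrite /rhombus_sum add0r sub0r !hyp_x0.
  have -> : hyp (b ^+ 2 / a) (- b) = b / a.
    apply/eqP; rewrite -(@eqrXn2 _ 2) ?hyp_ge0 ?divr_ge0 // sqr_hyp.
    apply/eqP; transitivity (b ^+ 2 * (a ^+ 2 + b ^+ 2) / a ^+ 2); first by field.
    by rewrite ab; field.
  have -> : hyp (b ^+ 2 / a) b = b / a.
    apply/eqP; rewrite -(@eqrXn2 _ 2) ?hyp_ge0 ?divr_ge0 // sqr_hyp.
    apply/eqP; transitivity (b ^+ 2 * (a ^+ 2 + b ^+ 2) / a ^+ 2); first by field.
    by rewrite ab; field.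
  rewrite ger0_norm; last by rewrite e divr_ge0.
  rewrite ler0_norm; last first.
    by rewrite subr_le0 ler_pdivrMr; nra.
  have -> : b ^+ 2 / a + a + - (b ^+ 2 / a - a) + b / a + b / a
     = (2 * a ^+ 2 + 2 * b) / a by field.
  by rewrite ler_pdivrMr; nra.
- rewrite /rhombus_sum !add0r subrr -[hyp (- a) b]hypNN opprK.
  rewrite hyp_x0 normr0 {2}/hyp sqrrN -/(hyp a b) hX hyp_swap hyp_x0 ger0_norm; lra.
Qed.

(** The estimate behind [rhombus_sum_axis]. For [t <= 2] the left side minus the
right side decreases with [t = sqrt 3 * b + a], because [K <= a]; so [t] may be
replaced by a linear function [l] of [a] below it. There remains a quartic
in [a], whose maximum near [a = 16 / 25] is slightly negative. *)
Lemma slanted_le a b : 1 / 2 < a -> 1 / 2 < b -> a ^+ 2 + b ^+ 2 = 1 ->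
  4 - 4 * a * (Num.sqrt 3 * b + a) <=
  (Num.sqrt 3 * b + a) ^+ 2 * ((303 / 200 - a) ^+ 2 - 1).
Proof.
move=> a12 b12 ab; set t := _ + a.
have s2 := sqrt3_sqr R; have /andP[sl su] := sqrt3_bounds R.
have a1 : a <= 13 / 15 by nra.
have t2 : t <= 2 by rewrite /t; nra.
have tl : 2 - 3 / 4 * (a - 1 / 2) <= t.
  suff : 19 / 8 - 7 / 4 * a <= Num.sqrt 3 * b by rewrite /t; lra.
  rewrite -[_ <= _](@ler_pXn2r _ 2) ?nnegrE ?mulr_ge0 ?sqrtr_ge0 //; try lra.
  rewrite exprMn s2.
  have : 0 <= (a - 1 / 2) * (169 / 32 - 97 / 16 * a).
    by apply: mulr_ge0; lra.
  nra.
set K := (a - 103 / 200) * (503 / 200 - a).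
have KE : (303 / 200 - a) ^+ 2 - 1 = - K by rewrite /K; field.
rewrite KE.
have Ka : K <= a by rewrite /K; nra.
set l := 2 - 3 / 4 * (a - 1 / 2) in tl *.
have mono : t ^+ 2 * K - 4 * a * t <= l ^+ 2 * K - 4 * a * l.
  have -> : t ^+ 2 * K - 4 * a * t = l ^+ 2 * K - 4 * a * l + (t - l) * ((t + l) * K - 4 * a) by ring.
  rewrite gerDl mulr_ge0_le0 ?subr_ge0 //.
  have : l <= 2 by rewrite /l; lra.
  have : 0 <= l by rewrite /l; lra.
  nra.
have : l ^+ 2 * K - 4 * a * l + 4 <= 0.
  (* 16 / 25 is close to the maximum; 13 / 15 - a absorbs the cubic term of the
     expansion there. *)
  have z2 := sqr_ge0 (a - 16 / 25).
  have : 0 <= (a - 16 / 25) ^+ 2 * (13 / 15 - a) by apply: mulr_ge0; lra.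
  have := sqr_ge0 ((a - 16 / 25) ^+ 2).
  rewrite /l /K; nra.
nra.
Qed.
End Rhombus.

Section RhombusBound.
Variable R : rcfType.
Implicit Types (a b x y : R).
Local Notation kappa := (kappa R).

(** Since [a + b <= sqrt 2] on the unit circle. *)
Lemma kappa_ge_diag a b : a ^+ 2 + b ^+ 2 = 1 ->
  (Num.sqrt 3 - 1) * (a + b) <= kappa.
Proof.
move=> ab; have s2 := sqrt3_sqr R; have /andP[sl su] := sqrt3_bounds R.
apply: le_trans (ler_norm _) _; rewrite -sqrtr_sqr.
apply: sqrt_le_of_sqr; first exact: kappa_ge0.
rewrite sqr_kappa exprMn.
have -> : (Num.sqrt 3 - 1 : R) ^+ 2 = 4 - 2 * Num.sqrt 3 by nra.
have := sqr_ge0 (a - b); nra.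
Qed.

Lemma lt_sqrt3_mul a b : 0 <= a -> 1 / 2 < b -> a ^+ 2 + b ^+ 2 = 1 ->
  a < Num.sqrt 3 * b.
Proof.
move=> a0 b12 ab; rewrite -[_ < _](@ltr_pXn2r _ 2) ?nnegrE //.
  by rewrite exprMn sqrt3_sqr; nra.
by rewrite mulr_ge0 ?sqrtr_ge0 //; lra.
Qed.

(** The corner of the region where both circular constraints are tight: the
apex of the equilateral triangle built inwards on the side [WZ]. Its
differences with [X] and [Y] point in directions making 60 and 30 degrees with
the first axis, so its distances to them are linear in [a] and [b]. *)
Lemma rhombus_sum_corner a b : 1 / 2 < a -> 1 / 2 < b -> a ^+ 2 + b ^+ 2 = 1 ->
  rhombus_sum a b ((Num.sqrt 3 * b - a) / 2) ((Num.sqrt 3 * a - b) / 2) <= 2 + kappa.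
Proof.
move=> a12 b12 ab; have s2 := sqrt3_sqr R; have /andP[sl su] := sqrt3_bounds R.
have x0 : 0 <= Num.sqrt 3 * b - a by rewrite subr_ge0 ltW ?lt_sqrt3_mul //; lra.
have y0 : 0 <= Num.sqrt 3 * a - b.
  by rewrite subr_ge0 ltW ?lt_sqrt3_mul // 1?addrC //; lra.
set x := _ / 2; set y := _ / 2.
have eqh u v w : 0 <= w -> u ^+ 2 + v ^+ 2 = w ^+ 2 -> hyp u v = w.
  by move=> w0 e; rewrite /hyp e sqrtr_sqr ger0_norm.
have unit2 : ((Num.sqrt 3 ^+ 2 + 1) * (a ^+ 2 + b ^+ 2)) / 4 = 1 ^+ 2 :> R.
  by rewrite s2 ab; field.
have chord2 (u v : R) : ((Num.sqrt 3 * v - 3 * u) / 2) ^+ 2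
    + ((Num.sqrt 3 * u - v) / 2) ^+ 2 = (Num.sqrt 3 * u - v) ^+ 2.
  have -> : (Num.sqrt 3 * u - v) ^+ 2 = (Num.sqrt 3 * u - v) ^+ 2
      + (Num.sqrt 3 ^+ 2 - 3) * (v ^+ 2 - 3 * u ^+ 2) / 4.
    by rewrite s2 subrr !mul0r addr0.
  by field.
rewrite /rhombus_sum.
have -> : hyp (x + a) y = 1 by apply: eqh => //; rewrite -unit2 /x /y; field.
have -> : hyp x (y + b) = 1 by apply: eqh => //; rewrite -unit2 /x /y; field.
have -> : hyp (x - a) y = Num.sqrt 3 * a - b.
  by apply: eqh => //; rewrite -chord2 /x /y; field.
have -> : hyp x (y - b) = Num.sqrt 3 * b - a.
  by apply: eqh => //; rewrite -chord2 /x /y; field.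
have := kappa_ge_diag ab; lra.
Qed.

(** The point where the tangent at the corner to the unit circle about [W]
meets the first axis. The constant 303 / 200 is half of [2 + 103 / 100], and
[kappa] is at least 103 / 100. *)
Lemma rhombus_sum_axis a b : 1 / 2 < a -> 1 / 2 < b -> a ^+ 2 + b ^+ 2 = 1 ->
  rhombus_sum a b (2 / (Num.sqrt 3 * b + a) - a) 0 <= 2 + kappa.
Proof.
move=> a12 b12 ab; have s2 := sqrt3_sqr R; have /andP[sl su] := sqrt3_bounds R.
have H := slanted_le a12 b12 ab.
set t := _ + a in H *.
have sb : a < Num.sqrt 3 * b by rewrite lt_sqrt3_mul //; lra.
have sa : b < Num.sqrt 3 * a by rewrite lt_sqrt3_mul // 1?addrC //; lra.
have t0 : 1 < t by rewrite /t; lra.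
have tn : t != 0 by apply/eqP; lra.
have ta : 1 <= a * t by rewrite /t; nra.
set g := _ - a.
have ga : g + a = 2 / t by rewrite /g; ring.
have a1 : a < 13 / 15 by nra.
have K : hyp g b <= 303 / 200 - a.
  apply: sqrt_le_of_sqr; first by lra.
  have -> : g ^+ 2 + b ^+ 2 = 1 + (4 - 4 * a * t) / t ^+ 2.
    by rewrite -{1}ab /g; field.
  rewrite -lerBrDl ler_pdivrMr; last by rewrite exprn_gt0 //; lra.
  by rewrite [leRHS]mulrC.
rewrite /rhombus_sum add0r sub0r !hyp_x0 ga.
have -> : hyp g (- b) = hyp g b by rewrite /hyp sqrrN.
have c0 : 0 <= 2 / t by rewrite divr_ge0 //; lra.
have g2 : g - a <= 0.
  rewrite /g; suff : 2 / t <= 2 * a by lra.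
  by rewrite ler_pdivrMr; lra.
rewrite ger0_norm // ler0_norm //.
have := kappa_ge R; have : g = 2 / t - a by [].
lra.
Qed.

(** Below the ray from the center to the corner, the disc about [W] is replaced
by its tangent at the corner. *)
Lemma rhombus_sum_sector a b x y : 1 / 2 < a -> 1 / 2 < b -> a ^+ 2 + b ^+ 2 = 1 ->
  0 <= y -> hyp (x + a) y <= 1 ->
  y * (Num.sqrt 3 * b - a) <= x * (Num.sqrt 3 * a - b) ->
  rhombus_sum a b x y <= 2 + kappa.
Proof.
move=> a12 b12 ab y0 hW sec.
have s2 := sqrt3_sqr R; have /andP[sl su] := sqrt3_bounds R.
have k := kappa_ge R.
set u := (Num.sqrt 3 * b - a) / 2; set v := (Num.sqrt 3 * a - b) / 2.
have v0 : 0 < v.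
  by rewrite /v divr_gt0 // subr_gt0 lt_sqrt3_mul // 1?addrC //; lra.
have e1 : (u + a) ^+ 2 + v ^+ 2 = 1.
  transitivity ((Num.sqrt 3 ^+ 2 + 1) * (a ^+ 2 + b ^+ 2) / 4).
    by rewrite /u /v; field.
  by rewrite s2 ab; field.
have h1 : hyp (u + a) v <= 1 by rewrite /hyp e1 sqrtr1.
have T := dot_le1 h1 hW.
have t0 : 0 < Num.sqrt 3 * b + a by nra.
have tn : Num.sqrt 3 * b + a != 0 by rewrite gt_eqF.
have ua : u + a = (Num.sqrt 3 * b + a) / 2 by rewrite /u; field.
apply: (@rhombus_sum_triangle R a b _ (u + a) v (1 - (u + a) * a)
          (2 / (Num.sqrt 3 * b + a) - a) u v) => //.
- by rewrite subr_gt0 ltr_pdivlMr //; nra.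
- by rewrite ua; lra.
- by rewrite ua; field.
- by nra.
- by rewrite /u /v; nra.
- by nra.
- exact: rhombus_sum_axis.
- exact: rhombus_sum_corner.
- by apply: rhombus_sum_center => //; lra.
Qed.

(** When [x] and [y] are nonnegative, [W] is farther than [Y] and [Z] farther
than [X], so only the discs about [W] and [Z] matter. Exchanging the axes
exchanges the two sides of the ray through the corner. *)
Lemma rhombus_sum_le a b x y : 0 <= a -> 0 <= b -> a ^+ 2 + b ^+ 2 = 1 ->
  0 <= x -> 0 <= y -> hyp (x + a) y <= 1 -> hyp x (y + b) <= 1 ->
  rhombus_sum a b x y <= 2 + kappa.
Proof.
move=> a0 b0 ab x0 y0 hW hZ; have k := kappa_ge R.
have ba : b ^+ 2 + a ^+ 2 = 1 by rewrite addrC.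
have hZ' : hyp (y + b) x <= 1 by rewrite hyp_swap.
case: (leP b (1 / 2)) => b12.
  by apply: le_trans (rhombus_sum_flat a0 b0 b12 ab x0 y0 hW) _; lra.
case: (leP a (1 / 2)) => a12.
  by rewrite rhombus_sum_swap; apply: le_trans (rhombus_sum_flat b0 a0 a12 ba y0 x0 hZ') _; lra.
case: (leP (y * (Num.sqrt 3 * b - a)) (x * (Num.sqrt 3 * a - b))) => sec.
  exact: rhombus_sum_sector.
by rewrite rhombus_sum_swap; apply: rhombus_sum_sector => //; exact: ltW.
Qed.
End RhombusBound.

(** * Perimeter of a quadrilateral in terms of its diagonals *)

Section Perimeter.
Variable R : rcfType.
Implicit Types (a b c p q r s x y : R).
Local Notation kappa := (kappa R).

(** Law of cosines: the side opposite to an angle of cosine [c] between sides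
[x] and [y]. *)
Definition chord c x y : R := Num.sqrt (x ^+ 2 + y ^+ 2 - 2 * c * x * y).

Lemma chord_ge0 c x y : 0 <= chord c x y.
Proof. exact: sqrtr_ge0. Qed.

Lemma chordC c x y : chord c x y = chord c y x.
Proof. by rewrite /chord; congr Num.sqrt; ring. Qed.

Lemma chordE c x y : -1 <= c <= 1 ->
  chord c x y = hyp (x - c * y) (Num.sqrt (1 - c ^+ 2) * y).
Proof.
move=> /andP[c1 c2]; rewrite /chord /hyp exprMn sqr_sqrtr; last by nra.
by congr Num.sqrt; ring.
Qed.

Lemma sqr_chord c x y : -1 <= c <= 1 ->
  chord c x y ^+ 2 = x ^+ 2 + y ^+ 2 - 2 * c * x * y.
Proof.
move=> cP; rewrite chordE // sqr_hyp exprMn sqr_sqrtr; last by case/andP: cP; nra.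
by ring.
Qed.

Lemma chord_leD c x y : -1 <= c <= 1 -> 0 <= x -> 0 <= y ->
  chord c x y <= x + y.
Proof.
move=> /andP[c1 c2] x0 y0; apply: sqrt_le_of_sqr; first exact: addr_ge0.
have := mulr_ge0 x0 y0; nra.
Qed.

Lemma chord_le1 c x y : -1 <= c <= 1 ->
  (chord c x y <= 1) = (x ^+ 2 + y ^+ 2 - 2 * c * x * y <= 1).
Proof.
by move=> cP; rewrite -sqr_chord // expr_le1 ?chord_ge0.
Qed.

Lemma opp_bounds1 c : -1 <= c <= 1 -> -1 <= - c <= 1.
Proof. by move=> /andP[c1 c2]; apply/andP; split; lra. Qed.

(** The end [p] of one diagonal moves on a line that crosses the segment between
the ends [r] and [s] of the other one. The sum of its distances to these
ends is convex in [p] and least at the crossing point [p = 0]. *)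
Lemma chord_pair_mono c p p' r s : -1 <= c <= 1 ->
  0 <= p -> p <= p' -> 0 <= r -> 0 <= s ->
  chord c p r + chord (- c) p s <= chord c p' r + chord (- c) p' s.
Proof.
move=> cP p0 pp' r0 s0; have cN := opp_bounds1 cP.
have [p'0|p'n] := eqVneq p' 0.
  by have -> : p = p' by lra.
have p'p : 0 < p' by rewrite lt_def p'n (le_trans p0 pp').
set k := p / p'.
have k0 : 0 <= k by rewrite divr_ge0 // ltW.
have k1 : k <= 1 by rewrite ler_pdivrMr // mul1r.
have k1' : 0 <= 1 - k by lra.
have pE : p = k * p' by rewrite divfK.
have H d y : -1 <= d <= 1 -> 0 <= y ->
    chord d p y <= k * chord d p' y + (1 - k) * y.
  move=> dP y0; rewrite !chordE //; set e := Num.sqrt _.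
  have yE : hyp (- d * y) (e * y) = y.
    by rewrite -[_ * y]add0r mulNr -chordE // /chord expr0n /= add0r mulr0 mul0r
       subr0 sqrtr_sqr ger0_norm.
  have := hyp_comb2 (p' - d * y) (e * y) (- d * y) (e * y) k0 k1'.
  by rewrite yE; congr (hyp _ _ <= _); [rewrite [in RHS]pE; ring | ring].
(* The triangle inequality between the two ends, through the moving point. *)
have base : r + s <= chord c p' r + chord (- c) p' s.
  rewrite !chordE // sqrrN; set e := Num.sqrt _.
  have rsE : hyp (c * (r + s)) (- (e * (r + s))) = r + s.
    rewrite /hyp sqrrN !exprMn sqr_sqrtr; last by case/andP: cP; nra.
    have -> : c ^+ 2 * (r + s) ^+ 2 + (1 - c ^+ 2) * (r + s) ^+ 2 = (r + s) ^+ 2.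
      by ring.
    by rewrite sqrtr_sqr ger0_norm ?addr_ge0.
  have -> : hyp (p' - - c * s) (e * s) = hyp (p' - - c * s) (- (e * s)).
    by rewrite /hyp sqrrN.
  rewrite -[hyp (p' - c * r) _]hypNN -[leLHS]rsE.
  have := hyp_triangle (- (p' - c * r)) (- (e * r)) (p' - - c * s) (- (e * s)).
  by congr (hyp _ _ <= _); ring.
have := H c r cP r0; have := H (- c) s cN s0; nra.
Qed.

(** The perimeter of [ABCD]: [p], [q], [r], [s] are the distances from the
crossing point of the diagonals to [A], [C], [B], [D], and [c] is the cosine
of the angle at this point between [A] and [B]. *)
Definition perim c p q r s : R :=
  chord c p r + chord (- c) q r + chord c q s + chord (- c) p s.

Definition sides_le1 c p q r s :=
  [/\ chord c p r <= 1, chord (- c) q r <= 1, chord c q s <= 1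
    & chord (- c) p s <= 1].

Lemma perim_le c p q r s p' q' : -1 <= c <= 1 ->
  0 <= p <= p' -> 0 <= q <= q' -> 0 <= r -> 0 <= s ->
  perim c p q r s <= perim c p' q' r s.
Proof.
move=> cP /andP[p0 pp'] /andP[q0 qq'] r0 s0.
have := chord_pair_mono cP p0 pp' r0 s0.
have := chord_pair_mono (opp_bounds1 cP) q0 qq' r0 s0.
rewrite opprK /perim; lra.
Qed.

Lemma perim_swap c p q r s : perim c r s p q = perim c p q r s.
Proof.
rewrite /perim (chordC c r p) (chordC _ s p) (chordC _ s q) (chordC _ r q).
by ring.
Qed.

Lemma sides_swap c p q r s : sides_le1 c p q r s -> sides_le1 c r s p q.
Proof.
case=> h1 h2 h3 h4; split; rewrite chordC //.
Qed.

(** Intermediate value theorem for a squared chord, monic in the moving length. *)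
Lemma quad_exit e f x0 x1 : x0 <= x1 -> x0 ^+ 2 + f - 2 * e * x0 <= 1 ->
  1 <= x1 ^+ 2 + f - 2 * e * x1 ->
  exists2 x, x0 <= x <= x1 & x ^+ 2 + f - 2 * e * x = 1.
Proof.
move=> x01 h0 h1.
pose P : {poly R} := 'X^2 - (2 * e) *: 'X + (f - 1)%:P.
have PE x : P.[x] = x ^+ 2 + f - 2 * e * x - 1.
  by rewrite /P !(hornerD, hornerN, hornerZ, hornerXn, hornerX, hornerC); ring.
have [|x xin /rootP] := @poly_ivt R P x0 x1 x01.
  by rewrite !PE; apply/andP; split; lra.
by rewrite PE => h; exists x => //; lra.
Qed.

Lemma chord_exit c r p0 p1 : -1 <= c <= 1 -> p0 <= p1 ->
  chord c p0 r <= 1 -> 1 <= chord c p1 r ->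
  exists2 p, p0 <= p <= p1 & chord c p r = 1.
Proof.
move=> cP p01; rewrite chord_le1 // => h0.
rewrite -(@expr_ge1 _ 2) ?chord_ge0 // sqr_chord // => h1.
have [||p pin e] := @quad_exit (c * r) (r ^+ 2) p0 p1 p01; try lra.
exists p => //; rewrite /chord.
have -> : p ^+ 2 + r ^+ 2 - 2 * c * p * r = 1 by rewrite -[RHS]e; ring.
exact: sqrtr1.
Qed.

Lemma chord_between c r p0 p1 p : -1 <= c <= 1 -> p0 <= p <= p1 ->
  chord c p0 r <= 1 -> chord c p1 r <= 1 -> chord c p r <= 1.
Proof.
move=> cP /andP[pl pr]; rewrite !chord_le1 // => h0 h1.
have [e|n] := eqVneq p0 p1; first by have -> : p = p0 by lra.
have lt01 : 0 < p1 - p0 by rewrite subr_gt0 lt_def eq_sym n; lra.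
rewrite -(ler_pM2l lt01).
have : 0 <= (p - p0) * (p1 - p) * (p1 - p0) by rewrite !mulr_ge0 //; lra.
have : 0 <= (p1 - p) * (1 - (p0 ^+ 2 + r ^+ 2 - 2 * c * p0 * r)).
  by apply: mulr_ge0; lra.
have : 0 <= (p - p0) * (1 - (p1 ^+ 2 + r ^+ 2 - 2 * c * p1 * r)).
  by apply: mulr_ge0; lra.
lra.
Qed.

(** The end of a diagonal stops where the first of the two sides at that end
reaches length 1. If this is not the side that was tried first, the latter is
at most 1 by convexity, since the end stays between two positions where it is. *)
Lemma slide_endpoint c d r s p0 p1 : -1 <= c <= 1 -> -1 <= d <= 1 -> p0 <= p1 ->
  chord c p0 r <= 1 -> chord d p0 s <= 1 ->
  exists p, [/\ p0 <= p <= p1, chord c p r <= 1, chord d p s <= 1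
    & [\/ p = p1, chord c p r = 1 | chord d p s = 1]].
Proof.
move=> cP dP p01 hc hd.
have [hc1|/ltW hc1] := leP (chord c p1 r) 1.
  have [hd1|/ltW hd1] := leP (chord d p1 s) 1.
    by exists p1; split; rewrite ?p01 ?lexx //; exact: Or31.
  have [p pin pe] := chord_exit dP p01 hd hd1.
  exists p; split; rewrite ?pe //; last exact: Or33.
  exact: chord_between cP pin hc hc1.
have [p pin pe] := chord_exit cP p01 hc hc1.
have [hd1|/ltW hd1] := leP (chord d p s) 1.
  by exists p; split; rewrite ?pe //; exact: Or32.
have [pl pr] := andP pin.
have [p' p'in p'e] := chord_exit dP pl hd hd1.
have [p'l p'r] := andP p'in.
exists p'; split; rewrite ?p'e //; last exact: Or33.
- by rewrite p'l (le_trans p'r pr).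
- by apply: chord_between cP p'in hc _; rewrite pe.
Qed.

(** Here [A] and [C] lie at distance 1 from [B], at most 60 degrees apart as seen from
[B], and [D] lies beyond [AC] in the unit disc of [B]. Such a point sees
[AC] under an angle at least that of the points of the circle, which bounds
[AD + DC] as for the middle of the arc. In the proof [m] is the distance
from [B] to the line [AC], and [- X] is the scalar product of [A - D] and
[C - D]. *)
Lemma isosceles c p q r s : -1 <= c <= 1 ->
  0 <= p -> 0 <= q -> 0 <= r -> 0 <= s -> p + q <= 1 -> r + s <= 1 ->
  chord c p r = 1 -> chord (- c) q r = 1 ->
  chord c q s + chord (- c) p s <= kappa.
Proof.
move=> cP p0 q0 r0 s0 pq rs hA hC.
have cN := opp_bounds1 cP; have /andP[c1 c2] := cP.
have eA := sqr_chord p r cP; have eC := sqr_chord q r cN.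
rewrite hA in eA; rewrite hC in eC.
have [l0|ln] := eqVneq (p + q) 0.
  have pz : p = 0 by lra. have qz : q = 0 by lra.
  have r1 : r = 1 by move: eA; rewrite pz; nra.
  have sz : s = 0 by lra.
  rewrite pz qz sz /chord expr0n /= !mulr0 !addr0 subr0 sqrtr0 addr0.
  exact: kappa_ge0.
have lp : 0 < p + q by rewrite lt_def ln addr_ge0.
have diff : p - q = 2 * r * c.
  apply: (mulfI ln); lra.
(* Stewart's theorem in the isosceles triangle ABC. *)
have prod : p * q = 1 - r ^+ 2.
  have -> : q = p - 2 * r * c by lra. lra.
have e1 := sqr_chord q s cP; have e2 := sqr_chord p s cN.
have d10 := chord_ge0 c q s; have d20 := chord_ge0 (- c) p s.
set d1 := chord c q s in e1 d10 *; set d2 := chord (- c) p s in e2 d20 *.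
set g := 1 - c ^+ 2.
have g0 : 0 <= g by rewrite /g; nra.
set m := r * Num.sqrt g.
have m0 : 0 <= m by rewrite mulr_ge0 ?sqrtr_ge0.
have m2 : m ^+ 2 = r ^+ 2 * g by rewrite exprMn sqr_sqrtr.
have l2 : (p + q) ^+ 2 = 4 * (1 - m ^+ 2).
  have -> : (p + q) ^+ 2 = (p - q) ^+ 2 + 4 * (p * q) by ring.
  by rewrite diff prod m2 /g; ring.
have l1 : (p + q) ^+ 2 <= 1 by rewrite expr_le1 ?addr_ge0.
have m34 : 3 / 4 <= m ^+ 2 by lra.
have m1 : m <= 1 by have := sqr_ge0 (p + q); nra.
set X := 1 - r ^+ 2 - s ^+ 2 - 2 * r * s * c ^+ 2.
have sumX : d1 ^+ 2 + d2 ^+ 2 + 2 * X = (p + q) ^+ 2.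
  have -> : (p + q) ^+ 2 = p ^+ 2 + q ^+ 2 + 2 * (p * q) by ring.
  rewrite e1 e2 prod /X.
  have -> : q = p - 2 * r * c by lra.
  by ring.
have Xge : 2 * r * s * g <= X.
  have : (r + s) ^+ 2 <= 1 by rewrite expr_le1 ?addr_ge0.
  by rewrite /X /g; lra.
have rsg0 : 0 <= 2 * r * s * g by rewrite !mulr_ge0.
have X0 : 0 <= X by exact: le_trans Xge.
have prodX : (d1 * d2) ^+ 2 = X ^+ 2 + (p + q) ^+ 2 * s ^+ 2 * g.
  have -> : X = p * q - s ^+ 2 - s * c * (p - q) by rewrite prod diff /X; ring.
  by rewrite exprMn e1 e2 /g; ring.
(* The inscribed angle at D: its cosine is at most - m. *)
have ang : m * (d1 * d2) <= X.
  have D0 : 0 <= m * (d1 * d2) by apply: mulr_ge0 m0 _; exact: mulr_ge0.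
  rewrite -[_ <= _](@ler_pXn2r _ 2) ?nnegrE //.
  rewrite exprMn prodX l2.
  have X2 : (2 * r * s * g) ^+ 2 <= X ^+ 2 by rewrite ler_pXn2r ?nnegrE.
  have : 0 <= (1 - m ^+ 2) * (X ^+ 2 - (2 * r * s * g) ^+ 2).
    by apply: mulr_ge0; nra.
  have -> : (2 * r * s * g) ^+ 2 = 4 * m ^+ 2 * s ^+ 2 * g by rewrite m2; ring.
  lra.
have S2 : (d1 + d2) ^+ 2 <= 8 * (1 - m).
  have key (u v w t : R) : t * (u * v) <= w ->
      u ^+ 2 + v ^+ 2 + 2 * w = 4 * (1 - t ^+ 2) ->
      0 <= (1 - t) * (u - v) ^+ 2 ->
      (u + v) ^+ 2 * (1 + t) <= 8 * (1 - t) * (1 + t).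
    by move=> h1 h2 h3; lra.
  have := key d1 d2 X m ang; rewrite sumX l2 => /(_ erefl).
  rewrite mulr_ge0 ?sqr_ge0 ?subr_ge0 // => /(_ isT).
  by rewrite ler_pM2r //; lra.
have s2 := sqrt3_sqr R; have s30 := sqrtr_ge0 (3 : R).
have msqrt : Num.sqrt 3 <= 2 * m by apply: sqrt_le_of_sqr; nra.
rewrite -[_ <= _](@ler_pXn2r _ 2) ?nnegrE ?addr_ge0 ?kappa_ge0 //.
rewrite sqr_kappa; lra.
Qed.

End Perimeter.

Section PerimeterBound.
Variable R : rcfType.
Implicit Types (a c p q r s x y : R).
Local Notation kappa := (kappa R).

Lemma hyp_norm_le1 a x y : hyp (x + a) y <= 1 -> hyp (x - a) y <= 1 ->
  hyp (`|x| + a) `|y| <= 1.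
Proof.
have -> : hyp (`|x| + a) `|y| = hyp (`|x| + a) y.
  by rewrite /hyp real_normK // num_real.
case: (ger0P x) => // _ _ h.
have -> : - x + a = - (x - a) by ring.
by rewrite /hyp sqrrN.
Qed.

(** When both diagonals have length 1, translating one of them so that the sides
start from a common point turns the four sides into the distances from a
point to the vertices of a rhombus of side 1, whose diagonals have lengths
[2 * a] and [2 * b]. *)
Lemma perim_unit c p q r s : -1 <= c <= 1 -> p + q = 1 -> r + s = 1 ->
  sides_le1 c p q r s -> perim c p q r s <= 2 + kappa.
Proof.
move=> /andP[c1 c2] pq rs [hAB hBC hCD hDA].
set a := Num.sqrt ((1 + c) / 2); set b := Num.sqrt ((1 - c) / 2).
have a0 : 0 <= a by exact: sqrtr_ge0.
have b0 : 0 <= b by exact: sqrtr_ge0.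
have a2 : a ^+ 2 = (1 + c) / 2 by rewrite sqr_sqrtr //; lra.
have b2 : b ^+ 2 = (1 - c) / 2 by rewrite sqr_sqrtr //; lra.
have ab : a ^+ 2 + b ^+ 2 = 1 by rewrite a2 b2; field.
set x := (q - p + r - s) / 2 * a; set y := (q - p - r + s) / 2 * b.
have qE : q = 1 - p by lra.
have sE : s = 1 - r by lra.
have eAB : chord c p r = hyp x (y - b).
  rewrite /chord /hyp; congr Num.sqrt; rewrite /x /y qE sE.
  transitivity ((p - r) ^+ 2 * a ^+ 2 + (p + r) ^+ 2 * b ^+ 2).
    by rewrite a2 b2; field.
  by field.
have eCD : chord c q s = hyp x (y + b).
  rewrite /chord /hyp; congr Num.sqrt; rewrite /x /y qE sE.
  transitivity ((r - p) ^+ 2 * a ^+ 2 + (2 - p - r) ^+ 2 * b ^+ 2).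
    by rewrite a2 b2; field.
  by field.
have eBC : chord (- c) q r = hyp (x + a) y.
  rewrite /chord /hyp; congr Num.sqrt; rewrite /x /y qE sE.
  transitivity ((1 - p + r) ^+ 2 * a ^+ 2 + (1 - p - r) ^+ 2 * b ^+ 2).
    by rewrite a2 b2; field.
  by field.
have eDA : chord (- c) p s = hyp (x - a) y.
  rewrite /chord /hyp; congr Num.sqrt; rewrite /x /y qE sE.
  transitivity ((p + 1 - r) ^+ 2 * a ^+ 2 + (1 - p - r) ^+ 2 * b ^+ 2).
    by rewrite a2 b2; field.
  by field.
rewrite eAB in hAB; rewrite eBC in hBC; rewrite eCD in hCD; rewrite eDA in hDA.
have -> : perim c p q r s = rhombus_sum a b `|x| `|y|.
  by rewrite rhombus_sum_norm /perim /rhombus_sum eAB eBC eCD eDA; ring.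
apply: rhombus_sum_le => //; first exact: hyp_norm_le1.
by rewrite hyp_swap; apply: hyp_norm_le1; rewrite hyp_swap.
Qed.

(** Both ends of the diagonal [AC] slide outwards. If it cannot reach length 1,
each end is blocked by a side of length 1. Two blocking sides with a common
end give the isosceles case; two opposite ones are together at most the sum
of the diagonals, which forces the diagonal to have length 1 after all. *)
Lemma perim_stretch c p q r s : -1 <= c <= 1 ->
  0 <= p -> 0 <= q -> 0 <= r -> 0 <= s -> p + q <= 1 -> r + s <= 1 ->
  sides_le1 c p q r s ->
  perim c p q r s <= 2 + kappa \/
  exists p' q', [/\ 0 <= p <= p', 0 <= q <= q', p' + q' = 1
    & sides_le1 c p' q' r s].
Proof.
move=> cP p0 q0 r0 s0 pq rs [hAB hBC hCD hDA]; have cN := opp_bounds1 cP.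
have p1q : p <= 1 - q by lra.
have [p' [/andP[pl pr] hAB' hDA' caseA]] := slide_endpoint cP cN p1q hAB hDA.
have p'0 : 0 <= p' by lra.
have p1q' : q <= 1 - p' by lra.
have [q' [/andP[ql qr] hBC' hCD' caseC]] := slide_endpoint cN cP p1q' hBC hCD.
have q'0 : 0 <= q' by lra.
have stretched : p' + q' = 1 -> exists p' q',
    [/\ 0 <= p <= p', 0 <= q <= q', p' + q' = 1 & sides_le1 c p' q' r s].
  by move=> e; exists p', q'; split; rewrite ?p0 ?q0.
have grow : perim c p q r s <= perim c p' q' r s.
  by apply: perim_le => //; rewrite ?p0 ?q0.
have pq' : p' + q' <= 1 by lra.
have leAB := chord_leD cP p'0 r0; have leDA := chord_leD cN p'0 s0.
have leBC := chord_leD cN q'0 r0; have leCD := chord_leD cP q'0 s0.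
case: caseA => eA; first by right; apply: stretched; lra.
  case: caseC => eC; first by right; apply: stretched; lra.
    left; apply: le_trans grow _.
    by have := isosceles cP p'0 q'0 r0 s0 pq' rs eA eC; rewrite /perim; lra.
  by right; apply: stretched; lra.
case: caseC => eC; [by right; apply: stretched; lra.. |].
left; apply: le_trans grow _.
have sr : s + r <= 1 by lra.
have eC' : chord (- - c) q' s = 1 by rewrite opprK.
have := isosceles cN p'0 q'0 s0 r0 pq' sr eA eC'.
by rewrite opprK /perim; lra.
Qed.

Lemma perim_le_kappa c p q r s : -1 <= c <= 1 ->
  0 <= p -> 0 <= q -> 0 <= r -> 0 <= s -> p + q <= 1 -> r + s <= 1 ->
  sides_le1 c p q r s -> perim c p q r s <= 2 + kappa.
Proof.
move=> cP p0 q0 r0 s0 pq rs sides.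
have [//|[p' [q' [/andP[_ pp'] /andP[_ qq'] pq' sides']]]] :=
  perim_stretch cP p0 q0 r0 s0 pq rs sides.
have p'0 := le_trans p0 pp'; have q'0 := le_trans q0 qq'.
have le1 : perim c p q r s <= perim c p' q' r s by apply: perim_le => //; apply/andP.
apply: le_trans le1 _; rewrite -perim_swap.
have pq'1 : p' + q' <= 1 by lra.
have [//|[r' [s' [/andP[_ rr'] /andP[_ ss'] rs' sides'']]]] :=
  perim_stretch cP r0 s0 p'0 q'0 rs pq'1 (sides_swap sides').
have le2 : perim c r s p' q' <= perim c r' s' p' q'.
  by apply: perim_le => //; apply/andP.
by apply: le_trans le2 _; exact: perim_unit.
Qed.

End PerimeterBound.

(** * Four points of the plane *)

Section FourPoints.
Variable R : rcfType.
Local Notation kappa := (kappa R).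

Definition dist (P Q : R * R) : R := hyp (P.1 - Q.1) (P.2 - Q.2).

Lemma dist_ge0 P Q : 0 <= dist P Q. Proof. exact: hyp_ge0. Qed.

Lemma distC P Q : dist P Q = dist Q P.
Proof. by rewrite /dist -hypNN !opprB. Qed.

Definition sum_dist P0 P1 P2 P3 : R :=
  dist P0 P1 + dist P0 P2 + dist P0 P3 + dist P1 P2 + dist P1 P3 + dist P2 P3.

Lemma sum_dist_swap01 P0 P1 P2 P3 : sum_dist P1 P0 P2 P3 = sum_dist P0 P1 P2 P3.
Proof. by rewrite /sum_dist (distC P1 P0); ring. Qed.
Lemma sum_dist_swap12 P0 P1 P2 P3 : sum_dist P0 P2 P1 P3 = sum_dist P0 P1 P2 P3.
Proof. by rewrite /sum_dist (distC P2 P1); ring. Qed.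
Lemma sum_dist_swap23 P0 P1 P2 P3 : sum_dist P0 P1 P3 P2 = sum_dist P0 P1 P2 P3.
Proof. by rewrite /sum_dist (distC P3 P2); ring. Qed.

Definition diam_le1 P0 P1 P2 P3 :=
  [/\ dist P0 P1 <= 1, dist P0 P2 <= 1 & dist P0 P3 <= 1] /\
  [/\ dist P1 P2 <= 1, dist P1 P3 <= 1 & dist P2 P3 <= 1].

(** For the zero vector any direction does, so that coinciding points need no
separate treatment. *)
Lemma polar_vec v1 v2 : exists u1 u2 : R, u1 ^+ 2 + u2 ^+ 2 = 1 /\
   v1 = hyp v1 v2 * u1 /\ v2 = hyp v1 v2 * u2.
Proof.
have s := sqr_hyp v1 v2.
have [e|n] := eqVneq (hyp v1 v2) 0.
  rewrite e expr0n /= in s; exists 1, 0; rewrite e !mul0r.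
  by split; [ring | split; nra].
exists (v1 / hyp v1 v2), (v2 / hyp v1 v2); split; last by split; field.
by rewrite !expr_div_n -mulrDl -s divff // expf_eq0.
Qed.

(** The common point of the segments splits them in the ratio of the weights;
the four sides are then chords for the angle between unit directions. *)
Lemma sum_dist_crossing P0 P1 P2 P3 (k0 k1 k2 k3 : R) :
  0 <= k0 -> 0 <= k1 -> 0 <= k2 -> 0 <= k3 -> k0 + k2 = 1 -> k1 + k3 = 1 ->
  k0 * P0.1 + k2 * P2.1 = k1 * P1.1 + k3 * P3.1 ->
  k0 * P0.2 + k2 * P2.2 = k1 * P1.2 + k3 * P3.2 ->
  diam_le1 P0 P1 P2 P3 -> sum_dist P0 P1 P2 P3 <= 4 + kappa.
Proof.
move=> k00 k10 k20 k30 k02 k13 E1 E2 [[h01 h02 h03] [h12 h13 h23]].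
have [u1 [u2 [u [U1 U2]]]] := polar_vec (P2.1 - P0.1) (P2.2 - P0.2).
have [v1 [v2 [v [V1 V2]]]] := polar_vec (P3.1 - P1.1) (P3.2 - P1.2).
set e := hyp _ _ in U1 U2; set f := hyp _ _ in V1 V2.
have e0 : 0 <= e by exact: hyp_ge0.
have f0 : 0 <= f by exact: hyp_ge0.
have e1 : e <= 1 by rewrite /e -/(dist P2 P0) distC.
have f1 : f <= 1 by rewrite /f -/(dist P3 P1) distC.
set c := u1 * v1 + u2 * v2.
have uv : c ^+ 2 + (u1 * v2 - u2 * v1) ^+ 2 = 1.
  transitivity ((u1 ^+ 2 + u2 ^+ 2) * (v1 ^+ 2 + v2 ^+ 2)).
    by rewrite /c; ring.
  by rewrite u v mulr1.
have cP : -1 <= c <= 1.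
  by apply/andP; split; have := sqr_ge0 (u1 * v2 - u2 * v1); nra.
set p := k2 * e; set q := k0 * e; set r := k3 * f; set s := k1 * f.
have p0 : 0 <= p by exact: mulr_ge0. have q0 : 0 <= q by exact: mulr_ge0.
have r0 : 0 <= r by exact: mulr_ge0. have s0 : 0 <= s by exact: mulr_ge0.
have pq : p + q <= 1 by rewrite -mulrDl addrC k02 mul1r.
have rs : r + s <= 1 by rewrite -mulrDl addrC k13 mul1r.
have chord_hyp d x y z1 z2 : d = u1 * z1 + u2 * z2 -> z1 ^+ 2 + z2 ^+ 2 = 1 ->
    chord d x y = hyp (x * u1 - y * z1) (x * u2 - y * z2).
  move=> -> z; rewrite /chord /hyp; congr Num.sqrt.
  transitivity (x ^+ 2 * (u1 ^+ 2 + u2 ^+ 2) + y ^+ 2 * (z1 ^+ 2 + z2 ^+ 2)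
     - 2 * (u1 * z1 + u2 * z2) * x * y); first by rewrite u z; ring.
  by ring.
have v' : (- v1) ^+ 2 + (- v2) ^+ 2 = 1 by rewrite !sqrrN.
have cN : - c = u1 * - v1 + u2 * - v2 by rewrite /c; ring.
have k2E : k2 = 1 - k0 by lra.
have k3E : k3 = 1 - k1 by lra.
have e01 : dist P0 P1 = chord c p r.
  rewrite (chord_hyp c p r v1 v2) // distC /dist /p /r -!mulrA -U1 -U2 -V1 -V2.
  by congr hyp; move: E1 E2; rewrite k2E k3E; lra.
have e12 : dist P1 P2 = chord (- c) q r.
  rewrite (chord_hyp (- c) q r (- v1) (- v2)) // distC /dist /q /r !mulrN.
  rewrite -!mulrA -U1 -U2 -V1 -V2.
  by congr hyp; move: E1 E2; rewrite k2E k3E; lra.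
have e23 : dist P2 P3 = chord c q s.
  rewrite (chord_hyp c q s v1 v2) // /dist /q /s -!mulrA -U1 -U2 -V1 -V2.
  by congr hyp; move: E1 E2; rewrite k2E k3E; lra.
have e03 : dist P0 P3 = chord (- c) p s.
  rewrite (chord_hyp (- c) p s (- v1) (- v2)) // distC /dist /p /s !mulrN.
  rewrite -!mulrA -U1 -U2 -V1 -V2.
  by congr hyp; move: E1 E2; rewrite k2E k3E; lra.
have sides : sides_le1 c p q r s by split; rewrite -?e01 -?e12 -?e23 -?e03.
have := perim_le_kappa cP p0 q0 r0 s0 pq rs sides.
rewrite /perim -e01 -e12 -e23 -e03 /sum_dist; lra.
Qed.

Lemma dist_comb P Q0 Q1 Q2 (k0 k1 k2 : R) : 0 <= k0 -> 0 <= k1 -> 0 <= k2 ->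
  k0 + k1 + k2 = 1 ->
  dist P (k0 * Q0.1 + k1 * Q1.1 + k2 * Q2.1, k0 * Q0.2 + k1 * Q1.2 + k2 * Q2.2)
   <= k0 * dist P Q0 + k1 * dist P Q1 + k2 * dist P Q2.
Proof.
move=> k00 k10 k20 k; rewrite /dist /=.
have := hyp_comb3 (P.1 - Q0.1) (P.2 - Q0.2) (P.1 - Q1.1) (P.2 - Q1.2)
   (P.1 - Q2.1) (P.2 - Q2.2) k00 k10 k20.
have -> : k0 = 1 - k1 - k2 by lra.
by congr (hyp _ _ <= _); ring.
Qed.

Lemma dist_xx P : dist P P = 0.
Proof. by rewrite /dist !subrr hyp_x0 normr0. Qed.

(** The distance to each vertex is convex, and [dist_comb] bounds the three
distances from the inner point together by 2; the total is at most 5. *)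
Lemma sum_dist_inside P0 P1 P2 P3 (k0 k1 k2 : R) :
  0 <= k0 -> 0 <= k1 -> 0 <= k2 -> k0 + k1 + k2 = 1 ->
  k0 * P0.1 + k1 * P1.1 + k2 * P2.1 = P3.1 ->
  k0 * P0.2 + k1 * P1.2 + k2 * P2.2 = P3.2 ->
  diam_le1 P0 P1 P2 P3 -> sum_dist P0 P1 P2 P3 <= 4 + kappa.
Proof.
move=> k00 k10 k20 k E1 E2 [[h01 h02 h03] [h12 h13 h23]].
have H P := dist_comb P P0 P1 P2 k00 k10 k20 k.
have P3E : (k0 * P0.1 + k1 * P1.1 + k2 * P2.1,
            k0 * P0.2 + k1 * P1.2 + k2 * P2.2) = P3.
  by rewrite E1 E2; case: (P3).
have := H P0; have := H P1; have := H P2; rewrite P3E !dist_xx.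
rewrite (distC P1 P0) (distC P2 P0) (distC P2 P1) /sum_dist.
have := kappa_ge R.
have : k2 = 1 - k0 - k1 by lra.
move: h01 h02 h12; set x := dist P0 P1; set y := dist P0 P2; set z := dist P1 P2.
nra.
Qed.
End FourPoints.

Section Radon.
Variable R : rcfType.
Local Notation kappa := (kappa R).
Implicit Types P : R * R.
Implicit Types k : R.

Definition sum_dist_bounded P0 P1 P2 P3 :=
  diam_le1 P0 P1 P2 P3 -> sum_dist P0 P1 P2 P3 <= 4 + kappa.

Lemma bounded_swap01 P0 P1 P2 P3 :
  sum_dist_bounded P1 P0 P2 P3 -> sum_dist_bounded P0 P1 P2 P3.
Proof.
move=> H [[h01 h02 h03] [h12 h13 h23]]; rewrite -sum_dist_swap01; apply: H.
by split; split => //; rewrite distC.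
Qed.

Lemma bounded_swap12 P0 P1 P2 P3 :
  sum_dist_bounded P0 P2 P1 P3 -> sum_dist_bounded P0 P1 P2 P3.
Proof.
move=> H [[h01 h02 h03] [h12 h13 h23]]; rewrite -sum_dist_swap12; apply: H.
by split; split => //; rewrite distC.
Qed.

Lemma bounded_swap23 P0 P1 P2 P3 :
  sum_dist_bounded P0 P1 P3 P2 -> sum_dist_bounded P0 P1 P2 P3.
Proof.
move=> H [[h01 h02 h03] [h12 h13 h23]]; rewrite -sum_dist_swap23; apply: H.
by split; split => //; rewrite distC.
Qed.

(** Radon's theorem is applied in this form: the signs of the coefficients decide
whether two segments cross or one point lies in the triangle of the others. *)
Definition affine_dep k0 k1 k2 k3 P0 P1 P2 P3 :=
  [/\ k0 + k1 + k2 + k3 = 0,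
      k0 * P0.1 + k1 * P1.1 + k2 * P2.1 + k3 * P3.1 = 0
    & k0 * P0.2 + k1 * P1.2 + k2 * P2.2 + k3 * P3.2 = 0].

Lemma bounded_crossing k0 k1 k2 k3 P0 P1 P2 P3 :
  affine_dep k0 k1 k2 k3 P0 P1 P2 P3 ->
  0 <= k0 -> 0 <= k1 -> k2 <= 0 -> k3 < 0 -> sum_dist_bounded P0 P1 P2 P3.
Proof.
move=> [E0 E1 E2] h0 h1 h2 h3; apply: bounded_swap12.
have S0 : 0 < k0 + k1 by lra.
have Sn : k0 + k1 != 0 by rewrite gt_eqF.
have k3E : k3 = - (k0 + k1) - k2 by lra.
move=> D; apply: (@sum_dist_crossing R P0 P2 P1 P3 (k0 / (k0 + k1)) (- k2 / (k0 + k1))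
  (k1 / (k0 + k1)) (- k3 / (k0 + k1))) => //.
1-4: by apply: divr_ge0; lra.
- by field.
- by rewrite k3E; field.
- apply: (mulfI Sn); transitivity (k0 * P0.1 + k1 * P1.1); first by field.
  by transitivity (- (k2 * P2.1 + k3 * P3.1)); [lra | field].
- apply: (mulfI Sn); transitivity (k0 * P0.2 + k1 * P1.2); first by field.
  by transitivity (- (k2 * P2.2 + k3 * P3.2)); [lra | field].
Qed.

Lemma bounded_inside k0 k1 k2 k3 P0 P1 P2 P3 :
  affine_dep k0 k1 k2 k3 P0 P1 P2 P3 ->
  0 <= k0 -> 0 <= k1 -> 0 <= k2 -> k3 < 0 -> sum_dist_bounded P0 P1 P2 P3.
Proof.
move=> [E0 E1 E2] h0 h1 h2 h3 D.
have n3 : k3 != 0 by rewrite lt_eqF.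
have k2E : k2 = - k3 - k0 - k1 by lra.
apply: (@sum_dist_inside R P0 P1 P2 P3 (k0 / - k3) (k1 / - k3) (k2 / - k3)) => //.
1-3: by apply: divr_ge0; lra.
- by rewrite k2E; field.
- apply: (mulfI n3); transitivity (- (k0 * P0.1 + k1 * P1.1 + k2 * P2.1)); [by field | lra].
- apply: (mulfI n3); transitivity (- (k0 * P0.2 + k1 * P1.2 + k2 * P2.2)); [by field | lra].
Qed.

Lemma bounded_of_dep k0 k1 k2 k3 P0 P1 P2 P3 :
  affine_dep k0 k1 k2 k3 P0 P1 P2 P3 ->
  ~ [/\ k0 = 0, k1 = 0, k2 = 0 & k3 = 0] -> sum_dist_bounded P0 P1 P2 P3.
Proof.
wlog k00 : k0 k1 k2 k3 / 0 <= k0.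
  move=> H dep nz; have [k00|/ltW k00] := leP 0 k0; first exact: (H k0 k1 k2 k3).
  apply: (H (- k0) (- k1) (- k2) (- k3)).
  - by rewrite oppr_ge0.
  - by case: dep => E0 E1 E2; split; lra.
  - by case=> e0 e1 e2 e3; apply: nz; split; lra.
move=> dep nz; have [E0 E1 E2] := dep.
have [h1|h1] := leP 0 k1; have [h2|h2] := leP 0 k2; have [h3|h3] := leP 0 k3.
- by exfalso; apply: nz; split; lra.
- exact: (bounded_inside dep).
- apply/bounded_swap23/(@bounded_inside k0 k1 k3 k2) => //.
  by split; lra.
- by apply: (bounded_crossing dep) => //; exact: ltW.
- apply/bounded_swap12/bounded_swap23/(@bounded_inside k0 k2 k3 k1) => //.
  by split; lra.
- apply/bounded_swap12/(@bounded_crossing k0 k2 k1 k3) => //; last exact: ltW.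
  by split; lra.
- apply/bounded_swap23/bounded_swap12/(@bounded_crossing k0 k3 k1 k2) => //; last exact: ltW.
  by split; lra.
- apply/bounded_swap01/bounded_swap12/bounded_swap23.
  apply: (@bounded_inside (- k1) (- k2) (- k3) (- k0)); try lra.
  by split; lra.
Qed.

(** Four points have four homogeneous coordinate vectors in a space of
dimension 3. *)
Lemma exists_affine_dep P0 P1 P2 P3 : exists k0 k1 k2 k3,
  affine_dep k0 k1 k2 k3 P0 P1 P2 P3 /\
  ~ [/\ k0 = 0, k1 = 0, k2 = 0 & k3 = 0].
Proof.
pose pt (i : 'I_4) := nth P0 [:: P0; P1; P2; P3] i.
pose M : 'M[R]_(4, 3) := \matrix_(i, j) nth 0 [:: 1; (pt i).1; (pt i).2] j.
have : kermx M != 0.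
  by rewrite -mxrank_eq0 mxrank_ker subn_eq0 -ltnNge ltnS rank_leq_col.
case/rowV0Pn => v /sub_kermxP vM vn0.
pose k n := v 0 (inord n).
have dep (j : 'I_3) : \sum_i v 0 i * M i j = 0.
  by have := congr1 (fun A : 'M_(1, 3) => A 0 j) vM; rewrite !mxE.
exists (k 0%N), (k 1%N), (k 2%N), (k 3%N); split.
  have E (j : 'I_3) : k 0%N * M (inord 0) j + k 1%N * M (inord 1) j
      + k 2%N * M (inord 2) j + k 3%N * M (inord 3) j = 0.
    rewrite -(dep j) !big_ord_recl big_ord0 /k addr0 !addrA.
    by congr (v 0 _ * M _ j + v 0 _ * M _ j + v 0 _ * M _ j + v 0 _ * M _ j);
      apply/val_inj => /=; rewrite inordK.
  by have := E (inord 0); have := E (inord 1); have := E (inord 2);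
     rewrite !mxE /pt !inordK //= => E2 E1 E0; split => //; lra.
case=> e0 e1 e2 e3; case/eqP: vn0; apply/rowP => i; rewrite mxE.
rewrite -(inord_val i); by case: i => [[|[|[|[|//]]]] /= _].
Qed.

Lemma sum_dist_le P0 P1 P2 P3 : sum_dist_bounded P0 P1 P2 P3.
Proof.
have [k0 [k1 [k2 [k3 [dep nz]]]]] := exists_affine_dep P0 P1 P2 P3.
exact: bounded_of_dep dep nz.
Qed.
End Radon.

(** * The maximum of the ratio *)

Section Ratio.
Variable R : realType.

Definition pt (v : 'rV[R]_2) : R * R := (v 0 0, v 0 1).

Lemma edistE (u v : 'rV[R]_2) : edist u v = dist (pt u) (pt v).
Proof.
rewrite /edist /dist /hyp !big_ord_recl big_ord0 addr0 /=.
have -> // : lift ord0 ord0 = 1 :> 'I_2; exact/val_inj.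
Qed.

Lemma sigmaE (A : 'I_4 -> 'rV[R]_2) :
  sigma A = sum_dist (pt (A 0)) (pt (A 1)) (pt (A 2)) (pt (A 3)).
Proof.
rewrite /sigma; under eq_bigr do rewrite big_mkcond /=.
rewrite !big_ord_recl !big_ord0 /= !edistE /sum_dist.
have -> : lift ord0 ord0 = 1 :> 'I_4 by exact/val_inj.
have -> : lift ord0 (lift ord0 ord0) = 2 :> 'I_4 by exact/val_inj.
have -> : lift ord0 (lift ord0 (lift ord0 ord0)) = 3 :> 'I_4 by exact/val_inj.
by rewrite !(add0r, addr0) !addrA.
Qed.

Lemma edist_le_diam (m n : nat) (A : 'I_n -> 'rV[R]_m) (i j : 'I_n) : (i < j)%N ->
  edist (A i) (A j) <= diam A.
Proof.
move=> ij; by apply: (bigmax_sup i) => //; exact: (bigmax_sup j).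
Qed.

Lemma diam_gt0 (A : 'I_4 -> 'rV[R]_2) : injective A -> 0 < diam A.
Proof.
move=> Ainj; have le01 := @edist_le_diam _ _ A 0 1 isT.
apply: lt_le_trans le01; rewrite edistE lt_def dist_ge0 andbT.
apply/eqP => d0; have := sqr_hyp ((pt (A 0)).1 - (pt (A 1)).1) ((pt (A 0)).2 - (pt (A 1)).2).
rewrite -/(dist _ _) d0 expr0n /= => /esym/eqP.
rewrite paddr_eq0 ?sqr_ge0 // !sqrf_eq0 !subr_eq0 => /andP[/eqP e1 /eqP e2].
have /Ainj // : A 0 = A 1.
apply/rowP => i; case: i => [[|[|//]] h].
- by rewrite (_ : Ordinal h = 0); [exact: e1 | exact/val_inj].
- by rewrite (_ : Ordinal h = 1); [exact: e2 | exact/val_inj].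
Qed.

(** Dividing the coordinates by the diameter reduces to diameter at most 1. *)
Lemma ratio_le (A : 'I_4 -> 'rV[R]_2) : injective A ->
  sigma A / diam A <= 4 + kappa R.
Proof.
move=> /diam_gt0 D0; set D := diam A in D0 *.
have Dn : D != 0 by rewrite gt_eqF.
have D1 : 0 <= D^-1 by rewrite invr_ge0 ltW.
pose P i := (D^-1 * (pt (A i)).1, D^-1 * (pt (A i)).2).
have dP i j : dist (P i) (P j) = dist (pt (A i)) (pt (A j)) / D.
  by rewrite /dist /= -!mulrBr hyp_scale // mulrC.
have -> : sigma A / D = sum_dist (P 0) (P 1) (P 2) (P 3).
  by rewrite sigmaE /sum_dist !dP -!mulrDl.
apply: sum_dist_le.
have le1 (i j : 'I_4) : (i < j)%N -> dist (P i) (P j) <= 1.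
  by move=> ij; rewrite dP ler_pdivrMr // mul1r -edistE edist_le_diam.
by split; split; apply: le1.
Qed.

(** An equilateral triangle of side 1 and the middle of one of the arcs of
radius 1 that join two of its vertices. *)
Definition kite_pts : seq (R * R) :=
  [:: (0, - (Num.sqrt 3 / 2)); (- (1 / 2), 0); (1 / 2, 0);
      (0, 1 - Num.sqrt 3 / 2)].

Definition kite (i : 'I_4) : 'rV[R]_2 :=
  \row_j (if j == 0 then (nth (0, 0) kite_pts i).1
          else (nth (0, 0) kite_pts i).2).

Lemma pt_kite i : pt (kite i) = nth (0, 0) kite_pts i.
Proof. by rewrite /pt !mxE /=; case: nth. Qed.

Lemma kite_inj : injective kite.
Proof.
have /andP[s1 s2] := sqrt3_bounds R.
move=> i j /(congr1 pt); rewrite !pt_kite.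
case: i j => [[|[|[|[|//]]]] hi] [[|[|[|[|//]]]] hj] /= e;
  solve [exact/val_inj | exfalso; move: (congr1 fst e) (congr1 snd e) => /=; lra].
Qed.

Lemma kite_dist (i j : 'I_4) : (i < j)%N ->
  edist (kite i) (kite j) =
    Num.sqrt (if (0 < i)%N && (j == 3) then 2 - Num.sqrt 3 else 1).
Proof.
have s2 := sqrt3_sqr R.
move=> ij; rewrite edistE !pt_kite /dist /hyp; congr Num.sqrt.
case: i j ij => [[|[|[|[|//]]]] hi] [[|[|[|[|//]]]] hj] //= _.
all: lra.
Qed.

Lemma kite_diam : diam kite = 1.
Proof.
have sm : Num.sqrt (2 - Num.sqrt 3) <= 1 :> R.
  have /andP[s1 s2] := sqrt3_bounds R.
  by apply: sqrt_le_of_sqr => //; lra.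
apply/le_anti/andP; split; last first.
  by have := @edist_le_diam _ _ kite 0 1 isT; rewrite kite_dist // sqrtr1.
apply: bigmax_le => // i _; apply: bigmax_le => // j ij.
by rewrite kite_dist //; case: ifP; rewrite ?sqrtr1.
Qed.

Lemma kite_sigma : sigma kite = 4 + kappa R.
Proof.
rewrite sigmaE /sum_dist -!edistE !kite_dist //= sqrtr1 /kappa.
by ring.
Qed.

End Ratio.

Theorem theorem3p1 (R : realType) :
  is_sup_omega 2 4 (4 + 2 * Num.sqrt (2 - Num.sqrt 3) : R).
Proof.
split.
  exists (@kite R); first exact: kite_inj.
  by rewrite kite_diam divr1 kite_sigma.
by move=> _ [A Ainj <-]; exact: ratio_le.
Qed.
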